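(* Let $\Sigma$ be a shuffling method such that, for every $k\ge 2$ and every $j\in\{1,\dots,k-1\}$, the set $(\Pi_{\Sigma}^{k})^{-1}=\{\sigma^{-1} : \sigma\in\Pi_{\Sigma}^{k}\}$ contains at least one permutation whose last entry (in one-line notation) is $j$. Then $S_n(\mathbb{Q}_{\Sigma}^{\textsf{pop}}) = S_n$ for every $n\ge 2$. In addition, $\mathbb{Q}_{\Sigma}^{\textsf{pop}}$ can sort every permutation using a single pop operation.
   Context: Permutations are written in one-line notation; $S_n$ is the set of permutations of $[n]=\{1,\dots,n\}$, $id_n = 12\cdots n$, and $\varepsilon$ is the empty sequence. A shuffling method $\Sigma$ is a family of sets $\Pi_{\Sigma}^{n}\subseteq S_n$, $n\ge 2$, with $id_n\notin\Pi_{\Sigma}^{n}$ for all $n\geq 2$. The pop shuffle queue $\mathbb{Q}_{\Sigma}^{\textsf{pop}}$ processes configurations $(s_{inp},s_{dev},s_{out})$ of three sequences (input, content of the device, output), starting from $(\pi,\varepsilon,\varepsilon)$ and ending at $(\varepsilon,\varepsilon,\pi')$, using freely chosen operations: push (move the first element of the input to the end of $s_{dev}$); pop (append the entire non-empty content $s_{dev}$, in order, to the end of the output, leaving the device empty); shuffle (if $s_{dev}=s_1\cdots s_m$ with $m\ge2$, choose $\sigma\in\Pi_{\Sigma}^{m}$ and replace the content by $s_{\sigma(1)}\cdots s_{\sigma(m)}$). A shuffle may not be applied immediately after another shuffle. $S_n(\mathbb{Q}_{\Sigma}^{\textsf{pop}})$ is the set of $\pi\in S_n$ for which the final output $\pi'=id_n$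 can be achieved; such a $\pi$ is said to be sorted by the device. *)

(* Defs.v *)
From mathcomp Require Import all_boot all_fingroup.

Set Implicit Arguments.
Unset Strict Implicit.
Unset Printing Implicit Defensive.

(* The members [Pi m] with m < 2 are irrelevant: they are unconstrained here
   and are never used by the device. *)
Record shuffling_method := ShufflingMethod {
  Pi : forall m : nat, {set 'S_m};
  id_notin_Pi : forall m : nat, 2 <= m -> 1%g \notin Pi m
}.

(* 'S_n acts on 0, ..., n-1; the entries of the one-line notation are shifted
   so as to range over 1, ..., n. *)
Definition one_line (n : nat) (pi : 'S_n) : seq nat :=
  [seq (pi i).+1 | i <- enum 'I_n].

Record config := Config { inp : seq nat; dev : seq nat; out : seq nat }.

Inductive op := Push | Pop | Shuffle.

Definition is_pop (o : op) : bool := if o is Pop then true else false.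
Definition is_shuffle (o : op) : bool := if o is Shuffle then true else false.

Inductive step (Sigma : shuffling_method) : op -> config -> config -> Prop :=
| step_push x i d o :
    step Sigma Push (Config (x :: i) d o) (Config i (rcons d x) o)
| step_pop i d o :
    d <> [::] ->
    step Sigma Pop (Config i d o) (Config i [::] (o ++ d))
| step_shuffle m (s : m.-tuple nat) (sigma : 'S_m) i o :
    2 <= m -> sigma \in Pi Sigma m ->
    step Sigma Shuffle (Config i s o)
      (Config i [tuple tnth s (sigma k) | k < m] o).

Inductive steps (Sigma : shuffling_method) : seq op -> config -> config -> Prop :=
| steps_nil c : steps Sigma [::] c c
| steps_cons a ops c1 c2 c3 :
    step Sigma a c1 c2 -> steps Sigma ops c2 c3 -> steps Sigma (a :: ops) c1 c3.

(* [sorted r] only compares neighbouring elements of a sequence. *)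
Definition no_consecutive_shuffles (ops : seq op) : bool :=
  sorted (fun a b => ~~ (is_shuffle a && is_shuffle b)) ops.

Definition sorts_with (Sigma : shuffling_method) (n : nat) (ops : seq op)
    (pi : 'S_n) : Prop :=
  no_consecutive_shuffles ops /\
  steps Sigma ops (Config (one_line pi) [::] [::])
    (Config [::] [::] (one_line (1%g : 'S_n))).

(* The set S_n(Q_Sigma^pop), as a predicate on 'S_n. *)
Definition pop_sortable (Sigma : shuffling_method) (n : nat) (pi : 'S_n) : Prop :=
  exists ops : seq op, sorts_with Sigma ops pi.

(* Main.v *)
Require Import Defs.
From mathcomp Require Import all_boot all_fingroup.

(** The device can be driven to _any_ arrangement of the symbols it has read,
    so it can be filled with the identity and popped once.  This is seen by
    reasoning backwards from the wanted content [d], of length [k]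
    ([fill_device]).  Let [x] be the last symbol read, occurring at position
    [j] of [d].  If [j] is the last position, it suffices to have arranged the
    other symbols beforehand and to push [x].  Otherwise the hypothesis gives
    [sigma] in [Pi Sigma k] whose inverse [tau] satisfies [tau k = j]; a
    shuffle by [sigma] produces [d] from the sequence [d o tau], whose last
    entry is [x], so [x] may just have been pushed on an arrangement of the
    symbols read before it ([unshuffle]).  How [sigma] moves those other
    symbols is arbitrary, but induction on the number of symbols read provides
    whichever arrangement of them that move calls for.  Each
    shuffle comes right after a push, so no two shuffles are adjacent. *)

Lemma steps_cat Sigma ops1 ops2 c1 c2 c3 :
  steps Sigma ops1 c1 c2 -> steps Sigma ops2 c2 c3 ->
  steps Sigma (ops1 ++ ops2) c1 c3.
Proof.
elim=> [//|a ops c c' c'' ac _ IH /IH]; exact: steps_cons.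
Qed.

Lemma steps1 Sigma a c1 c2 : step Sigma a c1 c2 -> steps Sigma [:: a] c1 c2.
Proof. by move=> ac; apply: steps_cons ac (steps_nil _ _). Qed.

Lemma no_consecutive_shuffles_cat ops1 a ops2 : ~~ is_shuffle a ->
  no_consecutive_shuffles (ops1 ++ a :: ops2)
  = no_consecutive_shuffles ops1 && no_consecutive_shuffles (a :: ops2).
Proof.
move=> /negbTE aNs; case: ops1 => [//|b ops1].
by rewrite /no_consecutive_shuffles /= cat_path /= aNs andbF.
Qed.

Lemma last_one_line n (tau : 'S_n.+1) : last 0 (one_line tau) = (tau ord_max).+1.
Proof. by rewrite /one_line enum_ordSr map_rcons last_rcons. Qed.

Lemma perm_one_line n (pi rho : 'S_n) : perm_eq (one_line pi) (one_line rho).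
Proof.
have perm_id (sigma : 'S_n) :
    perm_eq (one_line sigma) [seq (nat_of_ord i).+1 | i <- enum 'I_n].
  rewrite /one_line (map_comp (fun i : 'I_n => (nat_of_ord i).+1) sigma).
  apply: perm_map; apply: uniq_perm.
  - by rewrite (map_inj_uniq perm_inj) enum_uniq.
  - exact: enum_uniq.
  move=> i; rewrite mem_enum; apply/mapP; exists ((sigma^-1)%g i).
    by rewrite mem_enum.
  by rewrite permKV.
by apply: perm_trans (perm_id pi) _; rewrite perm_sym.
Qed.

Section Fill.

Variable Sigma : shuffling_method.
Hypothesis hSigma : forall k j : nat, 2 <= k -> 1 <= j <= k - 1 ->
  exists2 tau : 'S_k,
    tau \in [set (sigma^-1)%g | sigma in Pi Sigma k]
    & last 0 (one_line tau) = j.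

(** One shuffle can bring the last symbol of the device to any earlier
    position [j]: [d] is read through the inverse of a member of [Pi], and it
    is the last entry of that inverse, here [j.+1] since the entries of
    [one_line] start at 1, which decides what symbol of [d] came last. *)
Lemma unshuffle (d : seq nat) (j : nat) : j.+1 < size d ->
  exists s : seq nat,
    [/\ perm_eq (rcons s (nth 0 d j)) d
      & forall i o, step Sigma Shuffle
          (Config i (rcons s (nth 0 d j)) o) (Config i d o)].
Proof.
case Ed: (size d) => [//|k] ltjk.
have [|| tau /imsetP[sigma sigmaP ->]] := hSigma k.+1 j.+1.
- exact: leq_ltn_trans ltjk.
- by rewrite subn1.
rewrite last_one_line => -[tauj].
pose dt : k.+1.-tuple nat := Tuple (introT eqP Ed).
(* [t] is [d] before the shuffle by [sigma]; the entry [j] of [d] ends it. *)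
pose t := [tuple tnth dt ((sigma^-1)%g i) | i < k.+1].
have tE : rcons (belast (head 0 t) (behead t)) (nth 0 d j) = t.
  rewrite -tauj.
  have -> : nth 0 d ((sigma^-1)%g ord_max) = last (head 0 t) (behead t).
    have -> : last (head 0 t) (behead t) = nth 0 t k.
      case: (tval t) (size_tuple t) => //= a l [<-].
      by rewrite -last_nth.
    by rewrite -(tnth_nth 0 t ord_max) tnth_mktuple (tnth_nth 0).
  by rewrite -lastI; case: (tval t) (size_tuple t).
have shuffled : [tuple tnth t (sigma i) | i < k.+1] = dt.
  by apply: eq_from_tnth => i; rewrite !tnth_mktuple permK.
exists (belast (head 0 t) (behead t)); rewrite tE; split.
  by rewrite -[d]/(tval dt); apply/tuple_permP; exists (sigma^-1)%g.
move=> i o; have := step_shuffle t i o (leq_ltn_trans (leq0n j) ltjk) sigmaP.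
by rewrite shuffled.
Qed.

(** The target [d] is quantified inside the induction on [p], since the
    intermediate contents are dictated by the shuffles used later; so is the
    remaining input [i], since the last symbol of [p] is still waiting there
    while the others are being arranged. *)
Lemma fill_device (p d : seq nat) : perm_eq p d ->
  forall i o, exists2 ops,
    no_consecutive_shuffles ops && (count is_pop ops == 0)
    & steps Sigma ops (Config (p ++ i) [::] o) (Config i d o).
Proof.
elim/last_ind: p d => [|p x IH] d.
  move=> /perm_size/esym/size0nil-> i o; exists [::] => //; exact: steps_nil.
move=> pd i o; rewrite cat_rcons.
have xd : x \in d by rewrite -(perm_mem pd) mem_rcons mem_head.
have push_on s : perm_eq p s -> exists2 ops,
    no_consecutive_shuffles ops && (count is_pop ops == 0)
    & steps Sigma (rcons ops Push)
        (Config (p ++ x :: i) [::] o) (Config i (rcons s x) o).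
  move=> /IH/(_ (x :: i) o)[ops opsP run]; exists ops => //.
  rewrite -cats1; apply: steps_cat run (steps1 _ _ _ _ _); exact: step_push.
have := xd; rewrite -index_mem leq_eqVlt => /orP[/eqP ix|ix].
  have dE : d = rcons (take (index x d) d) x.
    have := xd; rewrite -index_mem => /(take_nth 0).
    by rewrite nth_index // ix take_size.
  move: pd; rewrite dE -cats1 -(cats1 _ x) perm_cat2r cats1.
  case/push_on=> ops /andP[opsS opsP] run.
  exists (rcons ops Push) => //.
  rewrite -cats1 no_consecutive_shuffles_cat // opsS.
  by rewrite count_cat (eqP opsP).
have [s [sd shuf]] := unshuffle d (index x d) ix.
rewrite nth_index // in sd shuf.
have /push_on[ops /andP[opsS opsP] run] : perm_eq p s.
  by rewrite -(perm_cat2r [:: x]) !cats1 (permPl pd) perm_sym.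
exists (rcons ops Push ++ [:: Shuffle]).
  by rewrite cat_rcons no_consecutive_shuffles_cat // opsS count_cat (eqP opsP).
exact: steps_cat run (steps1 _ _ _ _ (shuf _ _)).
Qed.

Lemma sorts_with_one_pop (n : nat) (pi : 'S_n) : 0 < n ->
  exists2 ops : seq op, sorts_with Sigma ops pi & count is_pop ops = 1.
Proof.
move=> n_gt0.
have [ops /andP[opsS /eqP opsP] run] :=
  fill_device _ _ (perm_one_line _ pi 1%g) [::] [::].
rewrite cats0 in run.
exists (ops ++ [:: Pop]); last by rewrite count_cat opsP.
split; first by rewrite no_consecutive_shuffles_cat // opsS.
apply: steps_cat run (steps1 _ _ _ _ _); apply: step_pop => /(congr1 size).
by rewrite size_map size_enum_ord => n0; rewrite n0 in n_gt0.
Qed.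

End Fill.

Theorem theorem5p1 (Sigma : shuffling_method)
    (hSigma : forall k j : nat, 2 <= k -> 1 <= j <= k - 1 ->
      exists2 tau : 'S_k,
        tau \in [set (sigma^-1)%g | sigma in Pi Sigma k]
        & last 0 (one_line tau) = j) :
  (forall n : nat, 2 <= n -> forall pi : 'S_n, pop_sortable Sigma pi) /\
  (forall n : nat, 1 <= n -> forall pi : 'S_n,
     exists2 ops : seq op, sorts_with Sigma ops pi & count is_pop ops = 1).
Proof.
have one_pop := sorts_with_one_pop _ hSigma.
split=> n n_gt pi; last exact: one_pop.
have [|ops opsP _] := one_pop n pi; first exact: ltnW.
by exists ops.
Qed.
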